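(* Let $L>0$ and let $\boldsymbol t\in W^{1,2}((0,L);\mathbb R^3)$ with $|\boldsymbol t|=1$ everywhere. Let $\{\boldsymbol d_1^0,\boldsymbol d_2^0\}$ and $\{\widetilde{\boldsymbol d}_1^0,\widetilde{\boldsymbol d}_2^0\}$ be such that $\{\boldsymbol t(0),\boldsymbol d_1^0,\boldsymbol d_2^0\}$ and $\{\boldsymbol t(0),\widetilde{\boldsymbol d}_1^0,\widetilde{\boldsymbol d}_2^0\}$ are two orthonormal bases of $\mathbb R^3$. Let $(u_1,u_2)$ be the solution in $L^2(0,L)$ of the integral equations $$u_1(s)=-\boldsymbol d_2^0\cdot\boldsymbol t'(s)-\int_0^s u_1(r)\,\boldsymbol t(r)\cdot\boldsymbol t'(s)\,dr,\qquad u_2(s)=\boldsymbol d_1^0\cdot\boldsymbol t'(s)-\int_0^s u_2(r)\,\boldsymbol t(r)\cdot\boldsymbol t'(s)\,dr,$$ and let $(\widetilde u_1,\widetilde u_2)$ be the solution of the same equations with $\boldsymbol d_1^0,\boldsymbol d_2^0$ replaced by $\widetilde{\boldsymbol d}_1^0,\widetilde{\boldsymbol d}_2^0$. Set $u=u_2+\mathrm i\,u_1$ and $\widetilde u=\widetilde u_2+\mathrm i\,\widetilde u_1$. Then $$|u|=|\widetilde u|$$ and $$\vartheta(u)-\vartheta(\widetilde u)=\alpha,$$ where $\alpha$ is a constant independent of $s$.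
   Context: For a complex-valued function $u$, $\vartheta(u)$ denotes the unique argument of $u$ in $[-\pi,\pi)$, so that $u=|u|e^{\mathrm i\vartheta(u)}$. For any $\boldsymbol d_1^0,\boldsymbol d_2^0$ completing $\boldsymbol t(0)$ to an orthonormal basis of $\mathbb R^3$, the integral equations have a unique solution $u_1,u_2\in L^2(0,L)$. Here $\boldsymbol t'\in L^2((0,L);\mathbb R^3)$ is the weak derivative of $\boldsymbol t$, and $\boldsymbol t$ is the unit tangent field of a curve parametrized by arc-length and obtained from $\boldsymbol t$ by integration.
   Formalization: The identity for ϑ is proved modulo 2π, for almost every s with u(s) ≠ 0, and only when the two orthonormal bases have the same orientation; without these provisos it is false. |u| = |ũ| is proved a.e. for arbitrary orthonormal bases. *)

(* Defs.v *)
From HB Require Import structures.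
From mathcomp Require Import all_boot all_order all_algebra.
From mathcomp Require Import complex.
From mathcomp Require Import all_classical all_reals all_analysis.

Set Implicit Arguments.
Unset Strict Implicit.
Unset Printing Implicit Defensive.

Import Order.TTheory GRing.Theory Num.Theory.
Import numFieldNormedType.Exports.

Local Open Scope classical_set_scope.
Local Open Scope ring_scope.

(* The library norm on 'rV[R]_n is the sup norm, hence [dot] and [enorm]. *)
Definition dot (R : realType) (v w : 'rV[R]_3) : R :=
  \sum_(i < 3) v ord0 i * w ord0 i.

Definition enorm (R : realType) (v : 'rV[R]_3) : R := Num.sqrt (dot v v).

Definition frame_mx (R : realType) (e1 e2 e3 : 'rV[R]_3) : 'M[R]_3 :=
  \matrix_(i < 3) tnth [tuple e1; e2; e3] i.

Definition orthonormal_basis (R : realType) (e1 e2 e3 : 'rV[R]_3) : Prop :=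
  (forall i j : 'I_3,
     dot (row i (frame_mx e1 e2 e3)) (row j (frame_mx e1 e2 e3)) = (i == j)%:R)
  /\ row_full (frame_mx e1 e2 e3).

(* f is only constrained on ]0, L[. *)
Definition L2 (R : realType) (L : R) (f : R -> R) : Prop :=
  f \_ `]0, L[ \in Lfun (@lebesgue_measure R) 2%:E.

(* Test functions: C^oo functions with compact support inside ]0, L[. *)
Definition test_function (R : realType) (L : R) (phi : R -> R) : Prop :=
  [/\ forall (n : nat) (x : R), derivable (derive1n n phi) x 1,
      compact (closure [set x | phi x != 0]) &
      closure [set x | phi x != 0] `<=` `]0, L[].

Definition weak_derivative (R : realType) (L : R) (f g : R -> R) : Prop :=
  forall phi : R -> R, test_function L phi ->
    (\int[@lebesgue_measure R]_(x in `]0%R, L[) (f x * derive1 phi x) =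
     - \int[@lebesgue_measure R]_(x in `]0%R, L[) (g x * phi x))%R.

(* t is the continuous representative on [0, L] of an element of
   W^{1,2}((0, L); R^3), which gives t 0 its meaning as a trace, and dt is
   (a representative of) its weak derivative t'. *)
Definition W12 (R : realType) (L : R) (t dt : R -> 'rV[R]_3) : Prop :=
  {within `[0, L], continuous t} /\
  forall i : 'I_3,
    [/\ L2 L (fun s => t s ord0 i), L2 L (fun s => dt s ord0 i) &
        weak_derivative L (fun s => t s ord0 i) (fun s => dt s ord0 i)].

(* (u1, u2) solves the integral equations with initial vectors d1, d2; as an
   identity in L^2 it is required for almost every s. *)
Definition bend_solution (R : realType) (L : R) (t dt : R -> 'rV[R]_3)
    (d1 d2 : 'rV[R]_3) (u1 u2 : R -> R) : Prop :=
  [/\ L2 L u1, L2 L u2,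
      {ae @lebesgue_measure R, forall s, `]0, L[%classic s ->
        u1 s = - dot d2 (dt s)
          - \int[@lebesgue_measure R]_(r in `[0%R, s])
              (u1 r * dot (t r) (dt s))} &
      {ae @lebesgue_measure R, forall s, `]0, L[%classic s ->
        u2 s = dot d1 (dt s)
          - \int[@lebesgue_measure R]_(r in `[0%R, s])
              (u2 r * dot (t r) (dt s))}]%R.

Definition bend (R : realType) (u1 u2 : R -> R) (s : R) : R[i] :=
  Complex (u2 s) (u1 s).

Definition is_argument (R : realType) (z : R[i]) (theta : R) : Prop :=
  - pi <= theta < pi /\ z = `|z| * Complex (cos theta) (sin theta).

Definition vartheta (R : realType) (z : R[i]) : R :=
  xget 0 [set theta | is_argument z theta].

Section VarthetaUnique.
Variable R : realType.

Let argument_formula (theta : R) : - pi <= theta < pi ->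
  theta = if 0 < sin theta then acos (cos theta) else - acos (cos theta).
Proof.
move=> /andP[h1 h2]; have [h0|h0] := ltP 0 theta.
  by rewrite sin_gt0_pi ?h0 ?h2 // cosK // in_itv /= !ltW.
rewrite ltNge -oppr_ge0 -sinN sin_ge0_pi /=; last by rewrite oppr_ge0 h0 lerNl.
by rewrite cosKN ?h1 ?h0 // opprK.
Qed.

Let argument_exists (z : R[i]) : z != 0 -> exists theta, is_argument z theta.
Proof.
case: z => a b z0; have r2 : 0 < a ^+ 2 + b ^+ 2.
  rewrite lt_neqAle addr_ge0 ?sqr_ge0 // andbT eq_sym paddr_eq0 ?sqr_ge0 //.
  by rewrite !sqrf_eq0; move: z0; rewrite eq_complex.
set r := Num.sqrt (a ^+ 2 + b ^+ 2).
have r0 : 0 < r by rewrite sqrtr_gt0.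
have rE : r ^+ 2 = a ^+ 2 + b ^+ 2 by rewrite sqr_sqrtr // ltW.
have xb : 1 - (a / r) ^+ 2 = (b / r) ^+ 2.
  rewrite !expr_div_n -[1](@divff _ (r ^+ 2)) ?gt_eqF ?exprn_gt0 //.
  by rewrite -mulrBl rE addrC addKr.
have x2 : (a / r) ^+ 2 <= 1 by rewrite -subr_ge0 xb sqr_ge0.
have x1 : -1 <= a / r <= 1 by rewrite -ler_norml -(@expr_le1 _ 2) // real_normK ?num_real.
have sE : sin (acos (a / r)) = `|b| / r.
  by rewrite sin_acos // xb sqrtr_sqr normrM normfV (gtr0_norm r0).
have key theta : cos theta = a / r -> sin theta = b / r ->
    Complex a b = `|Complex a b| * Complex (cos theta) (sin theta).
  move=> -> ->; rewrite normc_def /= -/r; apply/eqP; rewrite eq_complex /=.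
  rewrite !mul0r subr0 addr0 !(mulrC r) !divfK ?lt0r_neq0 //.
  by rewrite !eqxx.
have cE : cos (acos (a / r)) = a / r by rewrite acosK // in_itv.
have [b0|b0] := ltP 0 b.
  exists (acos (a / r)); split; last by apply: key; rewrite ?sE ?gtr0_norm.
  rewrite (le_trans _ (acos_ge0 x1)) ?oppr_le0 ?pi_ge0 //= acos_ltpi //.
  case/andP: x1 => x1 ->; rewrite andbT lt_neqAle x1 andbT.
  apply/eqP => xN; move/eqP: xb; rewrite -xN sqrrN expr1n subrr eq_sym.
  by rewrite sqrf_eq0 mulf_eq0 invr_eq0 !gt_eqF.
exists (- acos (a / r)); split.
  rewrite lerN2 acos_lepi // (le_lt_trans _ (pi_gt0 R)) //.
  by rewrite oppr_le0 acos_ge0.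
by apply: key; rewrite ?cosN ?sinN ?sE ?cE // ler0_norm // mulNr opprK.
Qed.

(* The hypothesis z <> 0 is necessary: every angle is an argument of 0. *)
Lemma vartheta_unique (z : R[i]) : z != 0 ->
  is_argument z (vartheta z) /\
  forall theta, is_argument z theta -> theta = vartheta z.
Proof.
move=> z0; have hv : is_argument z (vartheta z).
  by have [th hth] := argument_exists z0; apply: (xgetPex 0); exists th.
split=> // th [hth zth]; case: hv => hv zv.
have : Complex (cos th) (sin th)
     = Complex (cos (vartheta z)) (sin (vartheta z)).
  by apply: (@mulfI _ `|z|); rewrite ?normr_eq0 // -zth -zv.
case=> ec es.
by rewrite (argument_formula hth) (argument_formula hv) ec es.
Qed.

End VarthetaUnique.

(* Main.v *)
(** Write [dot d (dt s)] as a forcing term linear in the initial vector d: the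
integral equation is a linear Volterra equation, so a combination of solutions
solves the equation with the combined initial vector.  Both frames complete
[t 0], hence e1, e2 are an orthogonal combination of d1, d2, and uniqueness
makes (v2, v1) the image of (u2, u1) under an orthogonal map; when the frames
have the same orientation this map is multiplication by a unit complex number
a + ib, which shifts the argument by a constant.  Uniqueness holds because
|t| = 1 and t' is integrable: a solution f of the homogeneous equation satisfies
|f s| <= m s * \int_0^s |f| with m integrable, and m has integral less than 1/2
on short intervals. *)

Require Import Defs.
From HB Require Import structures.
From mathcomp Require Import all_boot all_order all_algebra.
From mathcomp Require Import complex.
From mathcomp Require Import all_classical all_reals all_analysis.
From mathcomp Require Import measurable_realfun ring lra.
Import Order.TTheory GRing.Theory Num.Theory.
Import numFieldNormedType.Exports.
Set Implicit Arguments.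
Unset Strict Implicit.
Unset Printing Implicit Defensive.
Local Open Scope classical_set_scope.
Local Open Scope ring_scope.

(* The library's hint for this filter fails to unify on [lebesgue_measure]. *)
#[local] Instance lebesgue_ae_filter (R : realType) :
  Filter (nbhs (almost_everywhere (@lebesgue_measure R))).
Proof. exact: (ae_filter_ringOfSetsType (@lebesgue_measure R)). Qed.

(** The Volterra inequality holds only almost everywhere, so a pointwise comparison would not
    suffice. Monotonicity is taken from the extended-real integral, and integrability makes both
    sides finite. *)
Lemma ae_ge0_le_Rintegral (d : measure_display) (T : measurableType d)
    (R : realType) (mu : {measure set T -> \bar R}) (D : set T) (f g : T -> R) :
  measurable D ->
  mu.-integrable D (EFin \o f) -> mu.-integrable D (EFin \o g) ->
  (forall x, D x -> 0 <= f x) -> (forall x, D x -> 0 <= g x) ->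
  {ae mu, forall x, D x -> f x <= g x} ->
  \int[mu]_(x in D) f x <= \int[mu]_(x in D) g x.
Proof.
move=> mD fi gi f0 g0 fg; apply: fine_le.
- exact: (integrable_fin_num mD fi).
- exact: (integrable_fin_num mD gi).
apply: ae_ge0_le_integral => //.
- exact: (measurable_int _ fi).
- exact: (measurable_int _ gi).
Qed.

(** * Vanishing of solutions of a linear Volterra inequality *)

Section Volterra.
Variables (R : realType) (w m : R -> R).
Local Notation mu := (@lebesgue_measure R).
Hypothesis wi : mu.-integrable setT (EFin \o w).
Hypothesis mi : mu.-integrable setT (EFin \o m).
Hypothesis m0 : forall s : R, 0 <= m s.

Let J (s : R) := \int[mu]_(r in `]0%R, s[) `|w r|.

Let wiS (D : set (measurableTypeR R)) : measurable D ->
  mu.-integrable D (EFin \o (fun r => `|w r|)).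
Proof.
move=> mD; apply: (@integrableS _ _ _ mu setT) => //.
exact: (integrable_norm wi).
Qed.

Let miS (D : set (measurableTypeR R)) : measurable D ->
  mu.-integrable D (EFin \o m).
Proof. by move=> mD; apply: (@integrableS _ _ _ mu setT). Qed.

Let J_ge0 (s : R) : 0 <= J s.
Proof. by apply: Rintegral_ge0. Qed.

Let J_split (a s : R) : 0 <= a -> a < s ->
  J s = J a + \int[mu]_(r in `]a, s[) `|w r|.
Proof.
move=> a0 as_; rewrite /J.
rewrite (@Rintegral_itv_bndo_bndc _ _ a); last exact: wiS.
rewrite -(@Rintegral_itvB _ _ (BRight 0) (BLeft s) a) ?bnd_simp //.
  by rewrite addrC subrK.
exact: wiS.
Qed.

Let J_le (r s : R) : r <= s -> J r <= J s.
Proof.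
rewrite le_eqVlt => /predU1P[->//|rs]; have [r0|r0] := leP 0 r.
  by rewrite (J_split r0 rs) lerDl; apply: Rintegral_ge0.
rewrite [J r](_ : _ = 0) // /J set_itv_ge ?Rintegral_set0 //.
by rewrite bnd_simp -leNgt ltW.
Qed.

(* On an interval where [m] has integral less than 1/2, the inequality gives
   [J s <= J s / 2] as soon as [J] vanishes at the left end. *)
Lemma volterra_ae0 :
  {ae mu, forall s : R, 0 < s ->
    `|w s| <= m s * \int[mu]_(r in `]0%R, s[) `|w r|} ->
  {ae mu, forall s : R, 0 < s -> w s = 0}.
Proof.
move=> hw.
have half_gt0 : (0 : R) < 2^-1 by rewrite invr_gt0.
(* Absolute continuity of the integral: sets of measure less than [d] carry less than 1/2 of the
   integral of [m]. *)
have [d [d0 hd]] := integral_normr_continuous mi half_gt0.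
(* Induction over steps of length [d / 2] rather than [d], because [hd] asks for measure strictly
   below [d]. *)
have hJ (n : nat) (s : R) : s <= d / 2 *+ n -> J s = 0.
  elim: n s => [s|n IH s hs].
    rewrite mulr0n => s0; rewrite /J set_itv_ge ?Rintegral_set0 //.
    by rewrite bnd_simp -leNgt.
  have [/IH //|ns] := leP s (d / 2 *+ n).
  have a0 : 0 <= d / 2 *+ n by rewrite mulrn_wge0 // ltW // divr_gt0.
  have Js := J_split a0 ns; rewrite (IH _ (lexx _)) add0r in Js.
  have mI : measurable `](d / 2 *+ n), s[%classic by exact: measurable_itv.
  (* Since [J] vanishes at the left end, only the last step contributes to [J s]; there [J r <= J s]
     replaces the running integral by a constant. *)
  have le1 : J s <= \int[mu]_(r in `](d / 2 *+ n), s[) (J s * m r).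
    rewrite {1}Js; apply: ae_ge0_le_Rintegral => //.
    - exact: wiS.
    - apply: (@eq_integrable _ _ _ mu _ mI
          (fun x => ((J s)%:E * (EFin \o m) x)%E)) => //.
      by apply: integrableZl => //; exact: miS.
    - by move=> x _; rewrite mulr_ge0.
    apply: filterS hw => r hr; rewrite /= in_itv /= => /andP[ar rs].
    apply: (le_trans (hr (le_lt_trans a0 ar))).
    by rewrite mulrC; exact: (ler_wpM2r (m0 r) (J_le (ltW rs))).
  rewrite RintegralZl // in le1; last exact: miS.
  have le2 : \int[mu]_(r in `](d / 2 *+ n), s[) m r < 2^-1.
    have -> : \int[mu]_(r in `](d / 2 *+ n), s[) m r =
              \int[mu]_(r in `](d / 2 *+ n), s[) `|m r|.
      by apply: eq_Rintegral => x _; rewrite ger0_norm.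
    have mua : (mu `](d / 2 *+ n)%R, s[%classic < d%:E)%E.
      rewrite lebesgue_measure_itv /= lte_fin ns -EFinD lte_fin.
      by rewrite mulrSr in hs; lra.
    exact: hd.
  have le3 := le_trans le1 (ler_wpM2l (J_ge0 s) (ltW le2)).
  apply/eqP; rewrite eq_le J_ge0 andbT; lra.
have J0 (s : R) : J s = 0.
  apply: (hJ (Num.truncn (s / (d / 2))).+1).
  have d20 : 0 < d / 2 by rewrite divr_gt0.
  rewrite -mulr_natl -ler_pdivrMr //.
  by rewrite ltW // truncnS_gt.
by apply: filterS hw => s h /h; rewrite -/(J s) J0 mulr0 normr_le0 => /eqP.
Qed.

End Volterra.

(** * Orthonormal frames and their change of basis *)

Section Frames.
Variable R : realType.
Implicit Types v w : 'rV[R]_3.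

Lemma dotE v w :
  dot v w = v ord0 0 * w ord0 0 + v ord0 1 * w ord0 1 + v ord0 2 * w ord0 2.
Proof.
rewrite /dot 3!big_ord_recl big_ord0 addr0 addrA.
by congr (_ * _ + _ * _ + _ * _); congr (_ ord0 _); apply/val_inj.
Qed.

Lemma row_frame_mx (e1 e2 e3 : 'rV[R]_3) i :
  row i (frame_mx e1 e2 e3) = tnth [tuple e1; e2; e3] i.
Proof. by apply/rowP => j; rewrite !mxE. Qed.

(** Orthonormality of the rows says that the transpose is a right inverse; for square matrices it is
    then also a left inverse. *)
Lemma frame_mxTK (e1 e2 e3 : 'rV[R]_3) : orthonormal_basis e1 e2 e3 ->
  (frame_mx e1 e2 e3)^T *m frame_mx e1 e2 e3 = 1%:M.
Proof.
case=> h _; apply: mulmx1C; apply/matrixP => i j; rewrite [RHS]mxE -h mxE.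
by apply: eq_bigr => k _; rewrite !mxE.
Qed.

Lemma orthonormal_basisE (e1 e2 e3 : 'rV[R]_3) : orthonormal_basis e1 e2 e3 ->
  [/\ dot e2 e2 = 1, dot e3 e3 = 1, dot e1 e2 = 0, dot e1 e3 = 0
    & dot e2 e3 = 0].
Proof.
case=> h _; have H i j := h i j.
move: (H 1 1) (H 2 2) (H 0 1) (H 0 2) (H 1 2).
by rewrite !row_frame_mx !(tnth_nth 0).
Qed.

Lemma frame_expansion (e1 e2 e3 v : 'rV[R]_3) : orthonormal_basis e1 e2 e3 ->
  v = dot v e1 *: e1 + dot v e2 *: e2 + dot v e3 *: e3.
Proof.
move=> /frame_mxTK h; rewrite -[LHS]mulmx1 -h mulmxA.
rewrite mulmx_sum_row 3!big_ord_recl big_ord0 addr0 addrA !row_frame_mx.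
rewrite !(tnth_nth 0) /=; congr (_ *: _ + _ *: _ + _ *: _);
by rewrite mxE; apply: eq_bigr => k _; rewrite !mxE.
Qed.

Lemma dotDl u v w : dot (u + v) w = dot u w + dot v w.
Proof. by rewrite !dotE !mxE; ring. Qed.

Lemma dotZl (a : R) v w : dot (a *: v) w = a * dot v w.
Proof. by rewrite !dotE !mxE; ring. Qed.

Lemma dotC v w : dot v w = dot w v.
Proof. by rewrite !dotE; ring. Qed.

(** Indexing the entries by [nat] lets the ordinals produced by cofactor expansion compute to
    numerals. *)
Lemma det3E (B : nat -> nat -> R) : \det (\matrix_(i < 3, j < 3) B i j) =
  B 0 0 * (B 1 1 * B 2 2 - B 1 2 * B 2 1)
  - B 0 1 * (B 1 0 * B 2 2 - B 1 2 * B 2 0)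
  + B 0 2 * (B 1 0 * B 2 1 - B 1 1 * B 2 0).
Proof.
rewrite (expand_det_row _ 0) 3!big_ord_recl big_ord0 /cofactor.
rewrite !(expand_det_row _ ord0) !big_ord_recl !big_ord0 /cofactor.
rewrite !det_mx11 !mxE /= /bump /= !(addn0, add0n) !addn1 !expr0 !expr1 expr2.
ring.
Qed.

Lemma det_frame_mx_comb (t d1 d2 : 'rV[R]_3) (a b c d : R) :
  \det (frame_mx t (a *: d1 + b *: d2) (c *: d1 + d *: d2)) =
  (a * d - b * c) * \det (frame_mx t d1 d2).
Proof.
have E u v w : let B i j := (nth 0 [:: u; v; w] i) ord0 (inord j) in
    \det (frame_mx u v w) = B 0 0 * (B 1 1 * B 2 2 - B 1 2 * B 2 1)
      - B 0 1 * (B 1 0 * B 2 2 - B 1 2 * B 2 0)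
      + B 0 2 * (B 1 0 * B 2 1 - B 1 1 * B 2 0).
  move=> B; rewrite -det3E; congr (\det _).
  by apply/matrixP => i j; rewrite !mxE /B inord_val (tnth_nth 0).
by rewrite !E /= !mxE; ring.
Qed.

(** The 2 x 2 coefficient matrix is orthogonal because expanding each frame in the other uses
    transposed coefficients. Equal determinants force [a * d - b * c = 1], which makes it a
    rotation. *)
Lemma orthogonal_frame_change (t d1 d2 e1 e2 : 'rV[R]_3) :
  orthonormal_basis t d1 d2 -> orthonormal_basis t e1 e2 ->
  exists a b c d : R, [/\ e1 = a *: d1 + b *: d2, e2 = c *: d1 + d *: d2,
    [/\ a ^+ 2 + c ^+ 2 = 1, b ^+ 2 + d ^+ 2 = 1 & a * b + c * d = 0] &
    \det (frame_mx t d1 d2) = \det (frame_mx t e1 e2) -> d = a /\ c = - b].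
Proof.
move=> hd he.
have [d11 d22 td1 td2 d12] := orthonormal_basisE hd.
have [e11 e22 te1 te2 e12] := orthonormal_basisE he.
have E1 := frame_expansion e1 hd; have E2 := frame_expansion e2 hd.
have D1 := frame_expansion d1 he; have D2 := frame_expansion d2 he.
(* All four vectors are orthogonal to [t], so its coefficient drops out of each expansion; by
   symmetry the same four products occur in [D1] and [D2]. *)
rewrite dotC te1 scale0r add0r in E1; rewrite dotC te2 scale0r add0r in E2.
rewrite dotC td1 scale0r add0r !(dotC d1) in D1.
rewrite dotC td2 scale0r add0r !(dotC d2) in D2.
exists (dot e1 d1), (dot e1 d2), (dot e2 d1), (dot e2 d2); split => //.
  split.
  - by rewrite -[RHS]d11 {3}D1 dotDl !dotZl !expr2.
  - by rewrite -[RHS]d22 {3}D2 dotDl !dotZl !expr2.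
  - by rewrite -[RHS]d12 {3}D1 dotDl !dotZl.
move=> hdet.
have nz : \det (frame_mx t d1 d2) != 0.
  by rewrite -unitfE -unitmxE -row_full_unit; exact: hd.2.
have [a2 c2] : dot e1 d1 ^+ 2 + dot e1 d2 ^+ 2 = 1 /\
               dot e2 d1 ^+ 2 + dot e2 d2 ^+ 2 = 1.
  split; [rewrite -[RHS]e11 {3}E1|rewrite -[RHS]e22 {3}E2];
  by rewrite dotDl !dotZl !(dotC _ d1) !(dotC _ d2) !expr2.
rewrite {1}E1 {1}E2 det_frame_mx_comb -{1}[\det _]mul1r in hdet.
move: hdet (mulIf nz) => /[swap] /[apply].
move: (dot e1 d1) (dot e1 d2) (dot e2 d1) (dot e2 d2) a2 c2.
move=> a b c d a2 c2 adbc.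
(* With unit rows this sum of squares equals [2 - 2 * (a * d - b * c)], so both squares vanish. *)
have : (d - a) ^+ 2 + (c + b) ^+ 2 = 0.
  transitivity ((a ^+ 2 + b ^+ 2) + (c ^+ 2 + d ^+ 2) - 2 * (a * d - b * c)).
    by ring.
  by rewrite a2 c2 -adbc; ring.
move=> /eqP; rewrite paddr_eq0 ?sqr_ge0 // !sqrf_eq0 subr_eq0 addr_eq0.
by move=> /andP[/eqP-> /eqP->].
Qed.
End Frames.

(** * Arguments of complex numbers modulo [2 * pi] *)

Section Arguments.
Variable R : realType.

Lemma periodicz (f : R -> R) (T : R) : periodic f T ->
  forall (k : int) x, f (x + k%:~R * T) = f x.
Proof.
move=> fT [] n x; first by rewrite -pmulrn mulr_natl (periodicn fT).
rewrite -[in RHS](subrK (T *+ n.+1) x) NegzE mulrNz -pmulrn mulNr mulr_natl.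
by rewrite (periodicn fT).
Qed.

(** The angle [x = th1 + vartheta w - th2] has cosine 1 and sine 0. Reduced to [[-pi, pi)] it is an
    argument of 1, as is 0, so uniqueness makes [x] a multiple of [2 * pi]. *)
Lemma unit_argument_shift (z w : R[i]) (th1 th2 : R) : `|w| = 1 ->
  is_argument z th1 -> is_argument (w * z) th2 -> z != 0 ->
  exists k : int, th1 - th2 = - vartheta w + k%:~R * (2 * pi).
Proof.
move=> w1 [_ z1] [_ z2] z0.
have w0 : w != 0 by rewrite -normr_eq0 w1 oner_eq0.
have [[_ ww] _] := vartheta_unique w0; rewrite w1 mul1r in ww.
set th := vartheta w in ww *.
have nz : `|z| != 0 by rewrite normr_eq0.
have pi0 := pi_gt0 R.
set x := th1 + th - th2.
have c2 : periodic (@cos R) (2 * pi) by rewrite mulr_natl; exact: cosD2pi.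
have s2 : periodic (@sin R) (2 * pi) by rewrite mulr_natl; exact: sinD2pi.
have [cx sx] : cos x = 1 /\ sin x = 0.
  rewrite normrM w1 mul1r {1}z1 ww mulrCA in z2.
  case: (mulfI nz z2) => c s.
  rewrite /x cosB sinB cosD sinD.
  have -> : cos th1 * cos th - sin th1 * sin th = cos th2 by rewrite -c; ring.
  have -> : sin th1 * cos th + cos th1 * sin th = sin th2 by rewrite -s; ring.
  by have := cos2Dsin2 th2 => <-; split; ring.
(* This [k] is the number of turns to remove for [x] to land in [[-pi, pi)]. *)
pose k := Num.floor ((x + pi) / (2 * pi)).
have h1 : is_argument (1 : R[i]) (x + (- k)%:~R * (2 * pi)).
  split; last first.
    by rewrite (periodicz c2) (periodicz s2) cx sx normr1 mul1r.
  have := floor_itv ((x + pi) / (2 * pi)); rewrite -/k.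
  rewrite ler_pdivlMr ?ltr_pdivrMr ?mulr_gt0 // rmorphN /= intrD.
  by move=> /andP[? ?]; apply/andP; split; lra.
have h0 : is_argument (1 : R[i]) 0.
  split; first by rewrite oppr_le0 ltW ?pi0.
  by rewrite cos0 sin0 normr1 mul1r.
have [_ u] := vartheta_unique (oner_neq0 R[i]).
exists k; move: (u _ h1); rewrite -(u _ h0) rmorphN /= /x; lra.
Qed.
End Arguments.

(** * Square-integrable functions on a bounded interval *)

Section SquareIntegrable.
Variables (R : realType) (L : R).
Local Notation mu := (@lebesgue_measure R).
Local Notation I := (`]0, L[%classic : set (measurableTypeR R)).

Lemma L2_measurable_fun (f : R -> R) : L2 L f -> measurable_fun I f.
Proof.
rewrite /L2 inE => /andP[+ _]; rewrite inE /= => mf.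
by apply/measurable_restrictT => //; exact: measurable_itv.
Qed.

Lemma integrable_itv_cst (c : R) : mu.-integrable I (EFin \o cst c).
Proof.
apply: (@integrableS _ _ _ mu `[0, L]) => //.
  by apply: subset_itv; rewrite bnd_simp.
apply: continuous_compact_integrable; first exact: segment_compact.
by apply: continuous_subspaceT => x; exact: cvg_cst.
Qed.

(** Domination by [1 + f ^+ 2], whose constant term is integrable because the interval is
    bounded. *)
Lemma L2_integrable (f : R -> R) : L2 L f -> mu.-integrable I (EFin \o f).
Proof.
move=> f2; have mI : measurable I by exact: measurable_itv.
have := Lfun2_integrable_sqr f2; set g := fun x => _ => gi.
have {}gi : mu.-integrable I (EFin \o g) by exact: integrableS gi.
have hi : mu.-integrable I (EFin \o (fun x => 1 + g x)).
  exact: (integrableD mI (integrable_itv_cst 1) gi).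
apply: (le_integrable mI _ _ hi).
  by apply/measurable_EFinP; exact: L2_measurable_fun.
move=> x Ix; rewrite /= lee_fin /g patchE mem_set //.
rewrite [leRHS]ger0_norm ?addr_ge0 ?sqr_ge0 // -real_normK ?num_real //.
by have := normr_ge0 (f x); nra.
Qed.

End SquareIntegrable.

(** * Uniqueness and linearity for the integral equation *)

Section BendEquation.
Variables (R : realType) (L : R) (t dt : R -> 'rV[R]_3).
Hypothesis ht : W12 L t dt.
Hypothesis ht1 : forall s : R, 0 <= s <= L -> enorm (t s) = 1.
Local Notation mu := (@lebesgue_measure R).
Local Notation I := (`]0, L[%classic : set (measurableTypeR R)).

(** The sum of absolute values is convenient here: along [dt] it is integrable because each
    component is. *)
Let onenorm (v : 'rV[R]_3) := `|v ord0 0| + `|v ord0 1| + `|v ord0 2|.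

(** Each coordinate of a unit vector has absolute value at most 1. *)
Lemma dot_tangent_le (s : R) v : 0 <= s <= L -> `|dot (t s) v| <= onenorm v.
Proof.
move=> /ht1; rewrite /enorm => h.
have h1 : dot (t s) (t s) = 1.
  have d0 : 0 <= dot (t s) (t s) by rewrite dotE -!expr2 !addr_ge0 ?sqr_ge0.
  by rewrite -(sqr_sqrtr d0) h expr1n.
have ti i : `|t s ord0 i| <= 1.
  rewrite -(@expr_le1 _ 2) // real_normK ?num_real // -h1 /dot.
  rewrite (bigD1 i) //= -expr2 lerDl sumr_ge0 // => j _.
  by rewrite -expr2 sqr_ge0.
rewrite dotE /onenorm; apply: (le_trans (ler_normD _ _)); apply: lerD.
  apply: (le_trans (ler_normD _ _)); apply: lerD; by rewrite normrM ler_piMl.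
by rewrite normrM ler_piMl.
Qed.

Lemma measurable_dot_tangent v : measurable_fun I (fun r => dot (t r) v).
Proof.
have mt i : measurable_fun I (fun r => t r ord0 i).
  by have [/L2_measurable_fun] := ht.2 i.
apply: measurable_sum => i; apply: measurable_funM; first exact: mt.
exact: measurable_cst.
Qed.

Lemma integrable_mul_dot (f : R -> R) v : mu.-integrable I (EFin \o f) ->
  mu.-integrable I (EFin \o (fun r => f r * dot (t r) v)).
Proof.
move=> fi; have mI : measurable I by exact: measurable_itv.
have gi : mu.-integrable I (EFin \o (fun r => onenorm v * f r)).
  exact: (integrableZl mI (onenorm v) fi).
apply: (le_integrable mI _ _ gi).
  apply/measurable_EFinP; apply: measurable_funM; last exact: measurable_dot_tangent.
  by apply/measurable_EFinP; exact: (measurable_int mu fi).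
move=> x /=; rewrite in_itv /= => /andP[x0 xL].
rewrite lee_fin !normrM mulrC ler_wpM2r //.
by rewrite [leRHS]ger0_norm ?addr_ge0 // dot_tangent_le // !ltW.
Qed.

Let sub_itv (s : R) : s <= L -> `]0, s[ `<=` I.
Proof. by move=> sL; apply: subset_itvl; rewrite bnd_simp. Qed.

(** The equations integrate over closed intervals, while measurability is known on the open ones;
    the endpoints form a null set. *)
Lemma Rintegral_itvcc_oo (s : R) (f : R -> R) :
  measurable_fun `]0, s[ f ->
  \int[mu]_(r in `[0, s]) f r = \int[mu]_(r in `]0, s[) f r.
Proof.
move=> mf; rewrite /Rintegral; congr fine.
by apply: integral_itv_bndoo; apply/measurable_EFinP.
Qed.

(** The kernel satisfies [|dot (t r) (dt s)| <= onenorm (dt s)], a bound independent of [r], which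
    turns the homogeneous equation into the Volterra inequality. *)
Lemma bend_equation_eq0 (f : R -> R) : mu.-integrable I (EFin \o f) ->
  {ae mu, forall s, I s ->
    f s = - \int[mu]_(r in `[0, s]) (f r * dot (t r) (dt s))} ->
  {ae mu, forall s, I s -> f s = 0}.
Proof.
move=> fi hf; have mI : measurable I by exact: measurable_itv.
have mi : mu.-integrable I (EFin \o (fun s => onenorm (dt s))).
  have di i : mu.-integrable I (EFin \o (fun s => `|dt s ord0 i|)).
    by apply: integrable_norm; apply: L2_integrable; have [] := ht.2 i.
  exact: (integrableD mI (integrableD mI (di 0) (di 1)) (di 2)).
(* Extension by zero, since [volterra_ae0] concerns functions integrable on the whole line. *)
pose w := f \_ I; pose m := (fun s => onenorm (dt s)) \_ I.
have wi : mu.-integrable setT (EFin \o w).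
  by rewrite -restrict_EFin; apply/(integrable_mkcond _ mI).
have mi' : mu.-integrable setT (EFin \o m).
  by rewrite -restrict_EFin; apply/(integrable_mkcond _ mI).
have m0 s : 0 <= m s by rewrite /m patchE; case: ifP => _ //; rewrite !addr_ge0.
have key : {ae mu, forall s : R, 0 < s ->
    `|w s| <= m s * \int[mu]_(r in `]0, s[) `|w r|}.
  apply: filterS hf => s hs s0; have [sI|sI] := pselect (I s); last first.
    rewrite {1}/w patchE memNset // normr0; apply: mulr_ge0; first exact: m0.
    by apply: Rintegral_ge0.
  have /andP[_ sL] : 0 < s < L by move: sI; rewrite /= in_itv.
  have sub := sub_itv (ltW sL).
  have ms : measurable (`]0, s[%classic : set (measurableTypeR R)) by exact: measurable_itv.
  have ki : mu.-integrable `]0, s[ (EFin \o (fun r => f r * dot (t r) (dt s))).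
    by apply: (integrableS mI) => //; exact: integrable_mul_dot.
  have fni : mu.-integrable `]0, s[ (EFin \o (fun r => `|f r|)).
    by apply: (integrableS mI) => //; exact: integrable_norm.
  have -> : \int[mu]_(r in `]0, s[) `|w r| = \int[mu]_(r in `]0, s[) `|f r|.
    by apply: eq_Rintegral => r /set_mem /sub rI; rewrite /w patchE mem_set.
  rewrite /w /m !patchE mem_set // hs // normrN Rintegral_itvcc_oo; last first.
    by apply/measurable_EFinP; exact: (measurable_int mu ki).
  apply: (le_trans (le_normr_Rintegral ms ki)).
  rewrite -RintegralZl //; apply: le_Rintegral => //.
  - exact: (integrable_norm ki).
  - exact: (integrableZl ms (onenorm (dt s)) fni).
  move=> r /=; rewrite in_itv /= => /andP[r0 rs].
  rewrite normrM mulrC ler_wpM2r // dot_tangent_le // ltW //=.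
  exact: (ltW (lt_trans rs sL)).
apply: filterS (volterra_ae0 wi mi' m0 key) => s ws sI.
have s0 : 0 < s by move: sI; rewrite /= in_itv => /andP[].
by have := ws s0; rewrite /w patchE mem_set.
Qed.

(** The difference [z] between [h] and the combination solves the homogeneous equation, because the
    forcing terms cancel. *)
Lemma bend_equation_comb (f g h : R -> R) (a b c : 'rV[R]_3) (x y : R) :
  L2 L f -> L2 L g -> L2 L h -> c = x *: a + y *: b ->
  {ae mu, forall s, I s ->
    f s = dot a (dt s) - \int[mu]_(r in `[0, s]) (f r * dot (t r) (dt s))} ->
  {ae mu, forall s, I s ->
    g s = dot b (dt s) - \int[mu]_(r in `[0, s]) (g r * dot (t r) (dt s))} ->
  {ae mu, forall s, I s ->
    h s = dot c (dt s) - \int[mu]_(r in `[0, s]) (h r * dot (t r) (dt s))} ->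
  {ae mu, forall s, I s -> h s = x * f s + y * g s}.
Proof.
move=> /L2_integrable fi /L2_integrable gi /L2_integrable hi cE hf hg hh.
have mI : measurable I by exact: measurable_itv.
pose z s := h s - (x * f s + y * g s).
have zi : mu.-integrable I (EFin \o z).
  have fgi : mu.-integrable I (EFin \o (fun s => x * f s + y * g s)).
    exact: (integrableD mI (integrableZl mI x fi) (integrableZl mI y gi)).
  exact: (integrableB mI hi fgi).
suff: {ae mu, forall s, I s -> z s = 0}.
  by apply: filterS => s zs /zs /eqP; rewrite subr_eq0 => /eqP.
apply: (bend_equation_eq0 zi).
apply: filterS3 hf hg hh => s fs gs hs sI.
have /andP[_ sL] : 0 < s < L by move: sI; rewrite /= in_itv.
have sub := sub_itv (ltW sL).
have ms : measurable (`]0, s[%classic : set (measurableTypeR R)) by exact: measurable_itv.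
have ki (u : R -> R) : mu.-integrable I (EFin \o u) ->
    mu.-integrable `]0, s[ (EFin \o (fun r => u r * dot (t r) (dt s))).
  by move=> ui; apply: (integrableS mI) => //; exact: integrable_mul_dot.
have kE (u : R -> R) : mu.-integrable I (EFin \o u) ->
    \int[mu]_(r in `[0, s]) (u r * dot (t r) (dt s)) =
    \int[mu]_(r in `]0, s[) (u r * dot (t r) (dt s)).
  move=> /ki ui; apply: Rintegral_itvcc_oo.
  by apply/measurable_EFinP; exact: (measurable_int mu ui).
rewrite {1}/z fs // gs // hs // !kE //.
set F := \int[mu]_(_ in _) (f _ * _); set G := \int[mu]_(_ in _) (g _ * _).
set H := \int[mu]_(_ in _) (h _ * _).
have -> : \int[mu]_(r in `]0, s[) (z r * dot (t r) (dt s)) = H - (x * F + y * G).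
  transitivity (\int[mu]_(r in `]0, s[) (h r * dot (t r) (dt s) -
    (x * (f r * dot (t r) (dt s)) + y * (g r * dot (t r) (dt s))))).
    by apply: eq_Rintegral => r _; rewrite /z; ring.
  rewrite RintegralB // ?RintegralD // ?RintegralZl //; try exact: ki.
  - exact: (integrableZl ms x (ki _ fi)).
  - exact: (integrableZl ms y (ki _ gi)).
  exact: (integrableD ms (integrableZl ms x (ki _ fi)) (integrableZl ms y (ki _ gi))).
by rewrite cE dotDl !dotZl; ring.
Qed.

End BendEquation.

(** * Comparison of the two complex solutions *)

Theorem theorem3p2 (R : realType) (L : R) (hL : 0 < L)
    (t dt : R -> 'rV[R]_3) (ht : W12 L t dt)
    (ht1 : forall s : R, 0 <= s <= L -> enorm (t s) = 1)
    (d1 d2 e1 e2 : 'rV[R]_3)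
    (hd : orthonormal_basis (t 0) d1 d2)
    (he : orthonormal_basis (t 0) e1 e2)
    (u1 u2 v1 v2 : R -> R)
    (hu : bend_solution L t dt d1 d2 u1 u2)
    (hv : bend_solution L t dt e1 e2 v1 v2) :
  {ae @lebesgue_measure R, forall s, `]0, L[%classic s ->
     `|bend u1 u2 s| = `|bend v1 v2 s|}
  /\
  (\det (frame_mx (t 0) d1 d2) = \det (frame_mx (t 0) e1 e2) ->
   exists alpha : R,
     {ae @lebesgue_measure R, forall s, `]0, L[%classic s ->
        bend u1 u2 s != 0 ->
        exists k : int,
          vartheta (bend u1 u2 s) - vartheta (bend v1 v2 s)
            = alpha + k%:~R * (2 * pi)}).
Proof.
have [a [b [c [d [e1E e2E [ac bd abcd] hdet]]]]] := orthogonal_frame_change hd he.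
case: hu => u1L u2L hu1 hu2; case: hv => v1L v2L hv1 hv2.
(* The equation for [u1] is the one for [u2] with [- d2] in place of [d1], so one lemma covers both
   components. *)
have dotN w z : - dot w z = dot (-1 *: w) z :> R by rewrite dotZl mulN1r.
have hv2E : {ae @lebesgue_measure R, forall s, `]0, L[%classic s ->
    v2 s = a * u2 s - b * u1 s}.
  have h : e1 = a *: d1 + (- b) *: (-1 *: d2) by rewrite scalerA mulrN1 opprK.
  apply: filterS (bend_equation_comb ht ht1 u2L u1L v2L h hu2 _ hv2).
    by move=> s vs /vs; rewrite mulNr.
  by apply: filterS hu1 => s us /us; rewrite dotN.
have hv1E : {ae @lebesgue_measure R, forall s, `]0, L[%classic s ->
    v1 s = d * u1 s - c * u2 s}.
  have h : -1 *: e2 = d *: (-1 *: d2) + (- c) *: d1.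
    by rewrite e2E scalerDr !scalerA mulN1r mulrN1 mulN1r addrC.
  apply: filterS (bend_equation_comb ht ht1 u1L u2L v1L h _ hu2 _).
  - by move=> s vs /vs; rewrite mulNr.
  - by apply: filterS hu1 => s us /us; rewrite dotN.
  - by apply: filterS hv1 => s us /us; rewrite dotN.
have hnorm : {ae @lebesgue_measure R, forall s, `]0, L[%classic s ->
     `|bend u1 u2 s| = `|bend v1 v2 s|}.
  apply: filterS2 hv1E hv2E => s h1 h2 sI.
  rewrite !normc_def /= h1 // h2 //; congr (Complex (Num.sqrt _) 0).
  (* The expanded square of the modulus of [v], grouped so that the column relations of the
     orthogonal matrix apply; no orientation is assumed. *)
  transitivity ((a ^+ 2 + c ^+ 2) * u2 s ^+ 2 + (b ^+ 2 + d ^+ 2) * u1 s ^+ 2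
    - 2 * (a * b + c * d) * u1 s * u2 s); last by ring.
  by rewrite ac bd abcd; ring.
(* With [d = a] and [c = - b], the linear map from [u] to [v] is multiplication by the unit number
   [a + ib], so [alpha] is minus its argument. *)
split=> // /hdet [dE cE]; exists (- vartheta (Complex a b)).
apply: filterS3 hv1E hv2E hnorm => s h1 h2 hn sI u0.
have vE : bend v1 v2 s = Complex a b * bend u1 u2 s.
  by rewrite /bend h1 // h2 // dE cE; apply/eqP; rewrite eq_complex /=;
     apply/andP; split; apply/eqP; ring.
have v0 : bend v1 v2 s != 0 by rewrite -normr_eq0 -hn // normr_eq0.
have ab1 : `|Complex a b| = 1.
  rewrite normc_def /= (_ : a ^+ 2 + b ^+ 2 = 1) ?sqrtr1 //.
  by rewrite -ac cE sqrrN.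
apply: (unit_argument_shift ab1 (vartheta_unique u0).1 _ u0).
by rewrite -vE; exact: (vartheta_unique v0).1.
Qed.
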